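(* (Recursion Theorem) Let $A\subseteq\omega$ be an infinite c.e. set and, for every $n\ge1$, let $\theta^{(n)}$ be a quasi-Gödel numbering of $\mathcal S^{(n)}_A$. Let $m,n\ge1$ and $f\in\mathcal R^{(m+1)}$. Then there is a function $e_f\in\mathcal R^{(m)}$ such that for all $\vec y\in\omega^m$, $$\theta^{(n)}_{f(e_f(\vec y),\vec y)}=\theta^{(n)}_{e_f(\vec y)}.$$
   Context: $\omega$ is the set of natural numbers; $\mathcal R^{(n)}$ is the set of total computable functions $\omega^n\to\omega$. $\langle\cdot,\cdot\rangle:\omega^2\to\omega$ is a computable bijection with $\langle x,y\rangle\ge x,y$, extended by $\langle x\rangle=x$, $\langle x_1,\dots,x_{n+1}\rangle=\langle x_1,\langle x_2,\dots,x_{n+1}\rangle\rangle$. $\mathrm{Anf}^{(n)}_A$ is the set of partial functions from $\omega^n$ to $\omega$ whose domain is either empty or equal to $\{0,\dots,a-1\}^n$ for some $a\in A$, and $\mathcal S^{(n)}_A=\mathcal R^{(n)}\cup\mathrm{Anf}^{(n)}_A$. The extended graph of an $n$-ary partial function $q$ is $\{\langle\langle\vec y\rangle,0\rangle:\vec y\in\omega^n\}\cup\{\langle\langle\vec x\rangle,q(\vec x)+1\rangle:\vec x\in\mathrm{dom}(q)\}$. A numbering of a set $X$ is a surjection $\omega\to X$. A numbering $\theta$ of $\mathcal S^{(n)}_A$ is a quasi-Gödel numbering if: (QGN I) the extended graph of $(i,\vec x)\mapsto\theta_i(\vec x)$ is the range of a function in $\mathcal R^{(1)}$; and (QGN II)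 for every $k\in\mathcal R^{(2)}$ there is $v\in\mathcal R^{(1)}$ such that for all $i\in\omega$, $r\in\mathcal S^{(n)}_A$: if $\{k(i,t):t\in\omega\}$ is the extended graph of $r$, then $r=\theta_{v(i)}$. *)

(* Defs.v *)
From mathcomp Require Import all_boot.
From mathcomp Require Import boolp classical_sets functions cardinality.

Set Implicit Arguments.
Unset Strict Implicit.
Unset Printing Implicit Defensive.

Local Open Scope classical_set_scope.

(* Programs for the (Kleene) partial recursive functions of each arity.
   The inner functions of a composition are given as a family on 'I_k. *)
Inductive recprog : nat -> Type :=
| RZero n : recprog n
| RSucc : recprog 1
| RProj n (i : 'I_n) : recprog n
| RComp k n (g : recprog k) (h : 'I_k -> recprog n) : recprog n
| RRec n (g : recprog n) (h : recprog n.+2) : recprog n.+1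
| RMin n (g : recprog n.+1) : recprog n.

(* [evalsto c x y] : program [c] halts on input [x] with output [y].
   RRec recurses on the first argument; [s] lists the intermediate values.
   RMin returns the least [y] with value 0, all smaller ones being required
   to have a defined, nonzero value. *)
Fixpoint evalsto n (c : recprog n) : n.-tuple nat -> nat -> Prop :=
  match c in recprog n return n.-tuple nat -> nat -> Prop with
  | RZero _ => fun _ y => y = 0
  | RSucc => fun x y => y = (thead x).+1
  | RProj _ i => fun x y => y = tnth x i
  | RComp k _ g h => fun x y => exists2 w : k.-tuple nat,
      forall i, evalsto (h i) x (tnth w i) & evalsto g w y
  | RRec _ g h => fun x y => exists s : nat -> nat,
      [/\ evalsto g [tuple of behead x] (s 0),
          forall j, j < thead x ->
            evalsto h [tuple of j :: s j :: behead x] (s j.+1)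
        & y = s (thead x)]
  | RMin _ g => fun x y => evalsto g [tuple of y :: x] 0 /\
      forall z, z < y -> exists u, evalsto g [tuple of z :: x] u.+1
  end.

Definition computable n : set (n.-tuple nat -> nat) :=
  [set f | exists c : recprog n, forall x, evalsto c x (f x)].

Definition ce_set (A : set nat) : Prop :=
  A = set0 \/ exists2 g, computable g & A = range (fun t => g [tuple t]).

Definition is_pairing (p : nat -> nat -> nat) : Prop :=
  [/\ computable (fun x : 2.-tuple nat => p (tnth x ord0) (tnth x ord_max)),
      bijective (fun xy : nat * nat => p xy.1 xy.2)
    & forall x y, x <= p x y /\ y <= p x y].

(* Only used on nonempty sequences; the value at [::] is irrelevant. *)
Fixpoint seqcode (p : nat -> nat -> nat) (s : seq nat) : nat :=
  match s with
  | [::] => 0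
  | [:: x] => x
  | x :: s' => p x (seqcode p s')
  end.

Definition parfun n := n.-tuple nat -> option nat.

Definition pdom n (q : parfun n) : set (n.-tuple nat) := [set x | q x <> None].

Definition Anf (A : set nat) n : set (parfun n) :=
  [set q | pdom q = set0 \/
     exists2 a, A a & pdom q = [set x | forall i, tnth x i < a]].
Arguments Anf : clear implicits.

Definition SA (A : set nat) n : set (parfun n) :=
  [set q | exists2 g, computable g & q = fun x => Some (g x)] `|` Anf A n.
Arguments SA : clear implicits.

Definition extgraph (p : nat -> nat -> nat) n (q : parfun n) : set nat :=
  [set z | exists y : n.-tuple nat, z = p (seqcode p y) 0] `|`
  [set z | exists (x : n.-tuple nat) b,
             q x = Some b /\ z = p (seqcode p x) b.+1].

Definition numbering T (X : set T) (theta : nat -> T) : Prop :=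
  range theta = X.

Definition univ n (theta : nat -> parfun n) : parfun n.+1 :=
  fun ix => theta (thead ix) [tuple of behead ix].

Definition QGN1 p n (theta : nat -> parfun n) : Prop :=
  exists2 h, computable h &
    range (fun t => h [tuple t]) = extgraph p (univ theta).

Definition QGN2 p A n (theta : nat -> parfun n) : Prop :=
  forall k : 2.-tuple nat -> nat, computable k ->
  exists2 v : 1.-tuple nat -> nat, computable v &
    forall i r, SA A n r ->
      range (fun t => k [tuple i; t]) = extgraph p r ->
      r = theta (v [tuple i]).

Definition quasi_Godel_numbering p A n (theta : nat -> parfun n) : Prop :=
  [/\ numbering (SA A n) theta, QGN1 p theta & QGN2 p A theta].

(* Main.v *)
Require Import Defs.
From mathcomp Require Import all_boot.
From mathcomp Require Import boolp classical_sets functions cardinality.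

(** Kleene's diagonal argument.  As [theta 1] numbers all unary computable
    functions and its graph is c.e., QGN II yields a computable [v] with
    [theta n (v i) = theta n b] whenever [theta 1 (p1 i) i = Some b], where
    [p1] is the first projection of the pairing.  If [j] is a [theta 1]-index
    of [<x, <y>> |-> f (v <x, <y>>) y], then [y |-> v <j, <y>>] is the required
    fixed point.  Partiality causes no trouble: QGN II makes [v] total, and
    nothing is needed from [v i] when [theta 1 (p1 i) i] is undefined. *)

Set Implicit Arguments.
Unset Strict Implicit.
Unset Printing Implicit Defensive.

Local Open Scope classical_set_scope.

(** * Closure properties of computable functions *)

Lemma computable_proj n (i : 'I_n) : computable (fun x => tnth x i).
Proof. by exists (RProj i). Qed.

Lemma computable_comp k n (g : k.-tuple nat -> nat)
    (h : 'I_k -> n.-tuple nat -> nat) :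
  computable g -> (forall i, computable (h i)) ->
  computable (fun x => g [tuple h i x | i < k]).
Proof.
move=> [cg cgP] ch; have [c cP] := choice ch.
exists (RComp cg c) => x /=; exists [tuple h i x | i < k] => // i.
by rewrite tnth_mktuple.
Qed.

Lemma computable_comp1 n (g : 1.-tuple nat -> nat) (a : n.-tuple nat -> nat) :
  computable g -> computable a -> computable (fun x => g [tuple a x]).
Proof.
move=> cg ca; have := computable_comp cg (fun=> ca).
congr computable; apply/funext => x; congr (g _).
by apply: eq_from_tnth => i; rewrite tnth_mktuple (ord1 i).
Qed.

Lemma computable_comp2 n (g : 2.-tuple nat -> nat) (a b : n.-tuple nat -> nat) :
  computable g -> computable a -> computable b ->
  computable (fun x => g [tuple a x; b x]).
Proof.
move=> cg ca cb.
have cab (i : 'I_2) : computable (if i == ord0 then a else b) by case: eqP.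
have := computable_comp cg cab.
congr computable; apply/funext => x; congr (g _).
by apply: eq_from_tnth => -[[|[|//]] i]; rewrite tnth_mktuple.
Qed.

(** Programs take tuples, whereas pairing and decoding take plain numbers; the two views agree by
    conversion, since [thead [tuple a x]] reduces to [a x]. *)
Lemma computable_app1 n (g : nat -> nat) (a : n.-tuple nat -> nat) :
  computable (fun x : 1.-tuple nat => g (thead x)) -> computable a ->
  computable (fun x => g (a x)).
Proof. exact: computable_comp1. Qed.

Lemma computable_app2 n (g : nat -> nat -> nat) (a b : n.-tuple nat -> nat) :
  computable (fun x : 2.-tuple nat => g (tnth x ord0) (tnth x ord_max)) ->
  computable a -> computable b -> computable (fun x => g (a x) (b x)).
Proof. exact: computable_comp2. Qed.

Lemma computable_succ n (a : n.-tuple nat -> nat) :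
  computable a -> computable (fun x => (a x).+1).
Proof. by apply: computable_app1; exists RSucc. Qed.

Lemma computable_const n c : computable (fun _ : n.-tuple nat => c).
Proof.
elim: c => [|c IHc]; first by exists (RZero n).
exact: computable_succ.
Qed.

Lemma computable_rec n (g : n.-tuple nat -> nat) (h : n.+2.-tuple nat -> nat) :
  computable g -> computable h ->
  computable (fun x : n.+1.-tuple nat =>
    nat_rect (fun=> nat) (g [tuple of behead x])
      (fun j s => h [tuple of j :: s :: behead x]) (thead x)).
Proof.
move=> [cg cgP] [ch chP]; exists (RRec cg ch) => x /=.
by exists (nat_rect (fun=> nat) (g [tuple of behead x])
      (fun j s => h [tuple of j :: s :: behead x])).
Qed.

(** [RMin] wants defined, nonzero values below the result; definedness comes from the totality of
    [g]. *)
Lemma computable_min n (g : n.+1.-tuple nat -> nat) (f : n.-tuple nat -> nat) :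
  computable g -> (forall x, g [tuple of f x :: x] = 0) ->
  (forall x z, z < f x -> g [tuple of z :: x] <> 0) -> computable f.
Proof.
move=> [c cP] f0 fmin; exists (RMin c) => x /=; split; first by rewrite -(f0 x).
move=> z /fmin; have := cP [tuple of z :: x].
by case: (g _) => // u; exists u.
Qed.

Lemma computable_pred n (a : n.-tuple nat -> nat) :
  computable a -> computable (fun x => (a x).-1).
Proof.
apply: computable_app1.
(* The recursion step returns its counter and drops the preceding value; the base value matches
   [0.-1 = 0]. *)
have := computable_rec (computable_const 0 0) (@computable_proj 2 ord0).
by congr computable; apply/funext => x; case: (thead x).
Qed.

Lemma computable_sub n (a b : n.-tuple nat -> nat) :
  computable a -> computable b -> computable (fun x => a x - b x).
Proof.
(* Recursion runs on the first argument, so the subtrahend is moved there; each step takes the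
   predecessor of the preceding value. *)
move=> ca cb; apply: (computable_app2 (g := fun x y => y - x) _ cb ca).
have := computable_rec (@computable_proj 1 ord0)
  (computable_pred (@computable_proj 3 (Ordinal (isT : 1 < 3)))).
congr computable; apply/funext => x.
rewrite /thead !(tnth_nth 0) /= nth_behead; elim: (nth 0 x 0) => [|j /= ->] /=.
  by rewrite subn0.
by rewrite !(tnth_nth 0) /= subnS.
Qed.

Lemma computable_if0 n (a b c : n.-tuple nat -> nat) :
  computable a -> computable b -> computable c ->
  computable (fun x => if a x == 0 then b x else c x).
Proof.
move=> ca cb cc.
pose g (x : 3.-tuple nat) :=
  if tnth x ord0 == 0 then tnth x (inord 1) else tnth x (inord 2).
have cg : computable g.
  (* Branching is a recursion whose step ignores the preceding value and returns the last
     argument. *)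
  have := computable_rec (@computable_proj 2 ord0) (@computable_proj 4 ord_max).
  congr computable; apply/funext => x; rewrite /g /thead !(tnth_nth 0) /=.
  rewrite !inordK // !nth_behead; case: (nth 0 x 0) => //= j.
  by rewrite (tnth_nth 0) /= nth_behead.
have cabc (i : 'I_3) : computable (nth a [:: a; b; c] i).
  by case: i => -[|[|[|]]].
have := computable_comp cg cabc; congr computable; apply/funext => x.
by rewrite /g !tnth_mktuple !inordK.
Qed.

(** Two numbers are equal exactly when both truncated differences vanish. *)
Lemma computable_if_eq n (a b c d : n.-tuple nat -> nat) :
  computable a -> computable b -> computable c -> computable d ->
  computable (fun x => if a x == b x then c x else d x).
Proof.
move=> ca cb cc cd.
have := computable_if0 (computable_sub ca cb)
  (computable_if0 (computable_sub cb ca) cc cd) cd.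
congr computable; apply/funext => x; rewrite !subn_eq0 eqn_leq.
by case: (_ <= _).
Qed.

(** * Computable unpairing and coding of tuples *)

Section Pairing.

Variables (p : nat -> nat -> nat) (p_pairing : is_pairing p).

Lemma computable_pair n (a b : n.-tuple nat -> nat) :
  computable a -> computable b -> computable (fun x => p (a x) (b x)).
Proof. by case: p_pairing => cp _ _; apply: computable_app2. Qed.

(* The search for the second component is bounded (by [p x y >= y]), so that
   the unbounded search for the first one never meets an undefined value. *)
Definition no_partner (b x z : nat) : nat :=
  nat_rect (fun=> nat) 1 (fun j s => if p x j == z then 0 else s) b.

Lemma no_partner_eq0 b x z :
  no_partner b x z = 0 <-> exists2 j, j < b & p x j = z.
Proof.
elim: b => [|b IHb]; first by split=> // -[].
rewrite /no_partner /= -/(no_partner b x z); case: eqP => [pz|pNz].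
  by split=> // _; exists b.
rewrite IHb; split=> -[j jb pj]; exists j => //; first exact: ltnW.
by move: jb; rewrite ltnS leq_eqVlt => /predU1P[jb|//]; rewrite jb in pj.
Qed.

Lemma computable_no_partner n (a b c : n.-tuple nat -> nat) :
  computable a -> computable b -> computable c ->
  computable (fun x => no_partner (a x) (b x) (c x)).
Proof.
move=> ca cb cc.
pose g (x : 3.-tuple nat) :=
  no_partner (tnth x ord0) (tnth x (inord 1)) (tnth x (inord 2)).
have cg : computable g.
  (* The step receives [j], the preceding value, [x] and [z], in this order. *)
  have ch := computable_if_eq
    (computable_pair (@computable_proj 4 (inord 2)) (computable_proj ord0))
    (computable_proj (inord 3)) (computable_const 4 0)
    (computable_proj (inord 1)).
  have := computable_rec (computable_const 2 1) ch.
  congr computable; apply/funext => x; rewrite /g /thead /no_partner.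
  elim: (tnth x ord0) => //= j ->.
  by rewrite !(tnth_nth 0) /= !inordK //= !nth_behead.
have cabc (i : 'I_3) : computable (nth a [:: a; b; c] i).
  by case: i => -[|[|[|]]].
have := computable_comp cg cabc; congr computable; apply/funext => x.
by rewrite /g !tnth_mktuple !inordK.
Qed.

(** Each component is found by minimising a total test; injectivity of [p] makes the solution
    unique, hence least. *)
Lemma computable_unpair : exists p1 p2 : nat -> nat,
  [/\ computable (fun x : 1.-tuple nat => p1 (thead x)),
      computable (fun x : 1.-tuple nat => p2 (thead x)),
      forall x y, p1 (p x y) = x, forall x y, p2 (p x y) = y
    & forall z, p (p1 z) (p2 z) = z].
Proof.
have [_ [q qK Kq] p_ge] := p_pairing.
pose p1 z := (q z).1; pose p2 z := (q z).2.
have p1K x y : p1 (p x y) = x by rewrite /p1 (qK (x, y)).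
have p2K x y : p2 (p x y) = y by rewrite /p2 (qK (x, y)).
have pK z : p (p1 z) (p2 z) = z by exact: Kq.
have cp1 : computable (fun x : 1.-tuple nat => p1 (thead x)).
  (* The input is the candidate followed by [z]. The bound [z.+1] suffices because the second
     component of [z] is at most [z]. *)
  apply: (computable_min (g := fun x => no_partner (tnth x ord_max).+1
    (tnth x ord0) (tnth x ord_max))).
  - apply: computable_no_partner (computable_proj _) (computable_proj _).
    exact/computable_succ/computable_proj.
  - move=> x; rewrite no_partner_eq0 /thead !(tnth_nth 0) /=.
    exists (p2 (nth 0 x 0)); last exact: pK.
    by have [_] := p_ge (p1 (nth 0 x 0)) (p2 (nth 0 x 0)); rewrite pK ltnS.
  - move=> x z zlt; rewrite no_partner_eq0 /thead !(tnth_nth 0) /= => -[j _ pz].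
    by move: zlt; rewrite /thead (tnth_nth 0) -pz p1K ltnn.
exists p1, p2; split=> //.
apply: (computable_min (g := fun x => if p (p1 (tnth x ord_max)) (tnth x ord0)
  == tnth x ord_max then 0 else 1)).
- apply: computable_if_eq (computable_proj _) (computable_const _ _)
    (computable_const _ _).
  by apply: computable_pair (computable_proj _); apply: computable_app1 cp1 _;
    apply: computable_proj.
- by move=> x; rewrite /thead !(tnth_nth 0) /= pK eqxx.
- move=> x z; rewrite /thead !(tnth_nth 0) /=; case: eqP => // <-.
  by rewrite p2K ltnn.
Qed.

Lemma seqcode_cons x s : 0 < size s -> seqcode p (x :: s) = p x (seqcode p s).
Proof. by case: s. Qed.

Lemma seqcode_surj n c : 0 < n -> exists y : n.-tuple nat, seqcode p y = c.
Proof.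
have [p1 [p2 [_ _ _ _ pK]]] := computable_unpair.
case: n => // n _; elim: n c => [|n IHn] c; first by exists [tuple c].
have [y yc] := IHn (p2 c); exists [tuple of p1 c :: y].
by rewrite seqcode_cons ?size_tuple // yc pK.
Qed.

Lemma computable_seqcode n : computable (fun x : n.-tuple nat => seqcode p x).
Proof.
(* Induction on [n] would change the arity of the input, so it runs over a list of coordinates
   instead. *)
have cs (s : seq 'I_n) :
    computable (fun x : n.-tuple nat => seqcode p [seq tnth x i | i <- s]).
  elim: s => [|i [|j s] IHs]; first exact: computable_const.
    exact: computable_proj.
  exact: computable_pair (computable_proj i) IHs.
have := cs (enum 'I_n); congr computable; apply/funext => x.
by rewrite map_tnth_enum.
Qed.

(** A code does not determine the length of its sequence, so the decoder depends on [m]: the last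
    component is stored bare, the others under [p]. *)
Lemma computable_decode m i : i < m -> exists2 D : nat -> nat,
  computable (fun x : 1.-tuple nat => D (thead x)) &
  forall s, size s = m -> D (seqcode p s) = nth 0 s i.
Proof.
have [p1 [p2 [cp1 cp2 p1K p2K _]]] := computable_unpair.
case: m => // m; elim: m i => [|m IHm] [|i] // im.
- by exists id; [exact: computable_proj|case=> [|x []]].
- by exists p1 => // -[//|x s] [sm]; rewrite seqcode_cons ?sm.
- have [D cD DP] := IHm i im; exists (fun c => D (p2 c)).
    exact: computable_app1 cD cp2.
  by move=> [//|x s] [sm]; rewrite seqcode_cons ?sm // p2K DP.
Qed.

Lemma computable_untuple m : exists D : nat -> m.-tuple nat,
  (forall i, computable (fun x : 1.-tuple nat => tnth (D (thead x)) i)) /\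
  forall y : m.-tuple nat, D (seqcode p y) = y.
Proof.
have /choice[D DP] : forall i : 'I_m, exists D : nat -> nat,
    computable (fun x : 1.-tuple nat => D (thead x)) /\
    forall y : m.-tuple nat, D (seqcode p y) = tnth y i.
  move=> i; have [D cD DP] := computable_decode (ltn_ord i).
  by exists D; split=> // y; rewrite (tnth_nth 0) DP ?size_tuple.
exists (fun c => [tuple D i c | i < m]); split=> [i|y].
  by have [cD _] := DP i; move: cD; congr computable; apply/funext => x;
    rewrite tnth_mktuple.
by apply: eq_from_tnth => i; rewrite tnth_mktuple; have [_ ->] := DP i.
Qed.

(** * Extended graphs and the diagonal *)

Lemma extgraph_univ n (theta : nat -> parfun n) b c u : 0 < n ->
  extgraph p (univ theta) (p (p b c) u) <-> extgraph p (theta b) (p c u).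
Proof.
move=> n_gt0; have [p1 [p2 [_ _ p1K p2K _]]] := computable_unpair.
(* Prefixing the index is pairing with it. This uses [0 < n]: the code of [[:: i]] is [i] itself. *)
have codeE i (y : n.-tuple nat) : seqcode p (i :: y) = p i (seqcode p y).
  by rewrite seqcode_cons ?size_tuple.
have pI x y x' y' : p x y = p x' y' -> x = x' /\ y = y'.
  by move=> e; rewrite -(p1K x y) -{2}(p2K x y) e p1K p2K.
split=> -[].
- move=> [y]; case/tupleP: y => i y; rewrite codeE.
  by move=> /pI[/pI[_ ->] ->]; left; exists y.
- move=> [y [d []]]; case/tupleP: y => i y; rewrite codeE /univ theadE => yd.
  move=> /pI[/pI[-> ->] ->]; right; exists y, d; split=> //.
  by rewrite -yd; congr theta; apply: val_inj.
- by move=> [y /pI[-> ->]]; left; exists [tuple of b :: y]; rewrite codeE.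
- move=> [y [d [yd /pI[-> ->]]]]; right; exists [tuple of b :: y], d.
  rewrite codeE; split=> //; rewrite -yd /univ theadE.
  by congr theta; apply: val_inj.
Qed.

Lemma diagonal_index A n (theta1 : nat -> parfun 1) (theta : nat -> parfun n)
    (s : nat -> nat) : 0 < n ->
  QGN1 p theta1 -> quasi_Godel_numbering p A theta ->
  computable (fun x : 1.-tuple nat => s (thead x)) ->
  exists2 v : 1.-tuple nat -> nat, computable v &
    forall i b, theta1 (s i) [tuple i] = Some b ->
      theta (v [tuple i]) = theta b.
Proof.
move=> n_gt0 [h1 ch1 h1P] [theta_num [h ch hP] theta_qgn2] cs.
have [p1 [p2 [cp1 cp2 p1K p2K pK]]] := computable_unpair.
(* [t] pairs positions in the enumerations of the graphs of [univ theta1] and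
   [univ theta]: an entry [(b, x)] of the latter is copied only once the former
   has shown that [theta1 (s i) i = b]; otherwise a trivial entry is output. *)
pose hit i z b := p (p (s i) i) b.+1 == z.
pose k (x : 2.-tuple nat) :=
  let i := tnth x ord0 in let t := tnth x ord_max in
  let w := h [tuple p2 t] in
  if hit i (h1 [tuple p1 t]) (p1 (p1 w)) then p (p2 (p1 w)) (p2 w) else p 0 0.
have ck : computable k.
  have ci := @computable_proj 2 ord0; have ct := @computable_proj 2 ord_max.
  have cw := computable_comp1 ch (computable_app1 cp2 ct).
  have cp1w := computable_app1 cp1 cw.
  apply: computable_if_eq (computable_comp1 ch1 (computable_app1 cp1 ct)) _ _.
  - apply: computable_pair (computable_succ (computable_app1 cp1 cp1w)).
    exact: computable_pair (computable_app1 cs ci) ci.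
  - exact: computable_pair (computable_app1 cp2 cp1w) (computable_app1 cp2 cw).
  - exact: computable_const.
have [v cv vP] := theta_qgn2 k ck; exists v => // i b def_b.
symmetry; apply: vP; first by rewrite -theta_num; exists b.
have kE t : k [tuple i; t] =
    if hit i (h1 [tuple p1 t]) (p1 (p1 (h [tuple p2 t])))
    then p (p2 (p1 (h [tuple p2 t]))) (p2 (h [tuple p2 t])) else p 0 0 by [].
rewrite predeqE => z; split.
- move=> [t _ <-]; rewrite kE /hit; case: eqP => [h1t|_]; last first.
    (* The filler [p 0 0] is in every extended graph, as 0 codes some [n]-tuple. *)
    by left; have [y <-] := seqcode_surj 0 n_gt0; exists y.
  have : range (fun t => h1 [tuple t]) (h1 [tuple p1 t]) by exists (p1 t).
  (* A hit cannot be a trivial entry, because its second component is a successor; so it records the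
     value of [theta1 (s i)] at [i], which is [b]. *)
  rewrite h1P -h1t extgraph_univ // => -[[y /(congr1 p2)]|[y [b' [yb']]]].
    by rewrite !p2K.
  move=> e; have := congr1 p1 e; have := congr1 p2 e; rewrite !p1K !p2K.
  move=> [def_b'] def_i.
  have {}def_b : p1 (p1 (h [tuple p2 t])) = b.
    have y_i : y = [tuple i].
      rewrite def_i; case/tupleP: (y) => a y'; rewrite (tuple0 y').
      exact: val_inj.
    by move: yb'; rewrite y_i def_b def_b' => -[].
  rewrite -[in theta _]def_b -extgraph_univ // !pK -hP.
  by exists (p2 t).
(* Conversely, the positions [t1] of the hit and [t2] of the entry to be copied combine into the
   stage [p t1 t2]. *)
- rewrite -(pK z) -extgraph_univ // -hP => -[t2 _ h_t2].
  have : extgraph p (univ theta1) (p (p (s i) i) b.+1).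
    by rewrite extgraph_univ //; right; exists [tuple i], b.
  rewrite -h1P => -[t1 _ h_t1]; exists (p t1 t2) => //.
  by rewrite kE /hit !(p1K, p2K) h_t1 h_t2 !(p1K, p2K) eqxx.
Qed.

End Pairing.

Theorem theorem4p9 (p : nat -> nat -> nat) (p_pairing : is_pairing p)
    (A : set nat) (A_infinite : infinite_set A) (A_ce : ce_set A)
    (theta : forall n : nat, nat -> parfun n)
    (theta_qgn : forall n : nat, 0 < n -> quasi_Godel_numbering p A (theta n))
    (m n : nat) (m_gt0 : 0 < m) (n_gt0 : 0 < n)
    (f : m.+1.-tuple nat -> nat) (f_computable : computable f) :
  exists2 e : m.-tuple nat -> nat, computable e &
    forall y : m.-tuple nat,
      theta n (f [tuple of e y :: y]) = theta n (e y).
Proof.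
have [p1 [p2 [cp1 cp2 p1K p2K _]]] := computable_unpair p_pairing.
have [D [cD DK]] := computable_untuple p_pairing m.
have [num1 qgn1 _] := theta_qgn 1 isT.
(* With [p1] as index function, an argument [p j c] carries both an index [j] and the code [c] of
   the parameters. *)
have [v cv vP] := diagonal_index p_pairing n_gt0 qgn1 (theta_qgn n n_gt0) cp1.
pose g (x : 1.-tuple nat) := f [tuple of v x :: D (p2 (thead x))].
have cg : computable g.
  have ch i : computable (fun x : 1.-tuple nat =>
      tnth [tuple of v x :: D (p2 (thead x))] i).
    case: (unliftP ord0 i) => [j|] ->.
      have := computable_app1 (g := fun c => tnth (D c) j) (cD j) cp2.
      by congr computable; apply/funext => x; rewrite tnthS.
    by move: cv; congr computable; apply/funext => x; rewrite tnth0.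
  have := computable_comp f_computable ch.
  congr computable; apply/funext => x; congr (f _).
  by apply: eq_from_tnth => i; rewrite tnth_mktuple.
have [j _ jP] : range (theta 1) (fun x => Some (g x)).
  by rewrite num1; left; exists g.
exists (fun y => v [tuple p j (seqcode p y)]).
  apply: computable_comp1 cv _.
  exact: (computable_pair p_pairing (computable_const m j)
    (computable_seqcode p_pairing m)).
(* At [p j (seqcode p y)] the diagonal value is [g] of that same argument, namely [f] applied to the
   candidate fixed point and [y]. *)
by move=> y; symmetry; apply: vP; rewrite p1K jP /g theadE p2K DK.
Qed.
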